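(* Let $(\lambda,\mu,A)$ be the nearly Kähler invariant $\mathrm{SU}(2)$-structure $(\eta,\omega_1,\omega_2,\omega_3)$ on $\mathrm{SU}(2)^2/\triangle\mathrm{U}(1)$, as described in the context. Then there is a one-parameter family of solutions $\theta_\gamma=\alpha\,\eta^{se}+k\,\theta^{se}$, with $k=\pm\frac12$ and $\alpha=\gamma t^{-3}$ for some constant $\gamma$, to the equations $$d\omega_3=4\eta\wedge\omega_2,\qquad d\theta\wedge\eta\wedge\omega_2=0,$$ $$2\omega_1^2-d(\eta\wedge\omega_1)=d\theta\wedge\omega_3+t\dot\theta\wedge\eta\wedge\omega_2,$$ $$d\omega_2+3\eta\wedge\omega_3=t\dot\theta\wedge\omega_1+d\theta\wedge\eta .$$
   Context: Let $E_1,E_2,E_3$ be a basis of $\mathfrak{su}(2)$ with $[E_i,E_j]=2E_k$ for $(ijk)$ cyclic permutations of $(123)$. Let $U^1=(E_1,0),V^1=(E_2,0),W^1=(E_3,0),U^2=(0,E_1),V^2=(0,E_2),W^2=(0,E_3)$ be left-invariant vector fields on $\mathrm{SU}(2)^2$, with dual 1-forms $u^1,v^1,w^1,u^2,v^2,w^2$. Let $U^\pm=U^1\pm U^2$, with dual 1-forms $u^\pm=\frac12(u^1\pm u^2)$; $U^+$ generates the diagonal $\triangle\mathrm{U}(1)$. Define $\eta^{se}=\frac43u^-$, $\theta^{se}=\frac43u^+$, $\omega_0^{se}=\frac23(v^1\wedge w^1+v^2\wedge w^2)$, $\omega_1^{se}=-\frac23(v^1\wedge w^1-v^2\wedge w^2)$,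 $\omega_2^{se}=\frac23(v^1\wedge v^2+w^1\wedge w^2)$, $\omega_3^{se}=\frac23(v^1\wedge w^2-w^1\wedge v^2)$. Invariant $\mathrm{SU}(2)$-structures on $\mathrm{SU}(2)^2/\triangle\mathrm{U}(1)$ are given by $(\lambda,\mu,A)\in\mathbb{R}_{>0}\times\mathbb{R}_{>0}\times\mathrm{SO}_0(1,3)$ via $\eta=\lambda\eta^{se}$, $\omega_i=\mu\sum_{j=0}^3A_{ij}\omega_j^{se}$, $i=1,2,3$ (indices of $A$ run over $0,\dots,3$). Invariant connection 1-forms on $\mathrm{SU}(2)^2\to\mathrm{SU}(2)^2/\triangle\mathrm{U}(1)$ are written $\theta=\alpha(t)\eta^{se}+k\theta^{se}$ with $k$ constant and $\alpha$ a function of $t\in\mathbb{R}_{>0}$; $\dot\theta=\partial_t\theta$, and $d$ denotes the exterior derivative at fixed $t$. The nearly Kähler $\mathrm{SU}(2)$-structure (the one corresponding to the Bryant--Salamon cone over the nearly Kähler $S^3\times S^3$) is given by $\lambda=\frac{\sqrt3}{2}$, $\mu=\frac{\sqrt3}{3}$, $\omega_1=\mu\omega_1^{se}$, $\omega_2=\frac{\sqrt3}{3}(\cos\vartheta\,\omega_2^{se}-\sin\vartheta\,\omega_3^{se})$ for a constant $\vartheta$, and $\omega_3=\mu(A_{30}\omega_0^{se}+A_{32}\omega_2^{se}+A_{33}\omega_3^{se})$ with $A_{30}=\mp\frac{\sqrt3}{3}$ (sign opposite to that of $k=\pm\frac12$), $A_{33}=\frac{2}{\sqrt3}\cos\vartheta$,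 $A_{32}=\frac{2}{\sqrt3}\sin\vartheta$. The first three equations are the conditions for the $\mathrm{G}_2$-structure $t\theta\wedge\omega_C+\mathrm{Re}\Upsilon_C$, with $\omega_C=t\,dt\wedge\eta+t^2\omega_1$, $\Upsilon_C=t^2(\omega_2+i\omega_3)\wedge(dt+it\eta)$, to be co-closed. *)

(* Defs.v *)
From HB Require Import structures.
From mathcomp Require Import all_boot all_order all_algebra all_fingroup.
From mathcomp Require Import all_classical all_reals all_analysis.
From mathcomp.real_closed Require Import complex.
From mathcomp Require Import lra.
Set Implicit Arguments.
Unset Strict Implicit.
Unset Printing Implicit Defensive.
Import Order.TTheory GRing.Theory Num.Theory.
Import numFieldNormedType.Exports.
Local Open Scope ring_scope.

(* 'M[R[i]]_2 is canonically a module over R[i], not over R; the real vector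
   space su(2) is therefore built on the subtype of skew-Hermitian traceless
   matrices. *)

Section Su2.
Variable R : realType.

Definition skew_traceless : {pred 'M[R[i]]_2} :=
  fun X => (map_mx (@conjc R) X^T == - X) && (\tr X == 0).

Fact skew_traceless_zmod : zmod_closed skew_traceless.
Proof.
split=> [|X Y]; rewrite !unfold_in.
  by rewrite trmx0 map_mx0 oppr0 eqxx mxtrace0 eqxx.
move=> /andP[/eqP hX /eqP tX] /andP[/eqP hY /eqP tY].
by rewrite linearB /= map_mxB hX hY opprB opprK addrC eqxx linearB /= tX tY subr0 eqxx.
Qed.
HB.instance Definition _ :=
  GRing.isZmodClosed.Build _ skew_traceless skew_traceless_zmod.

Record su2 := Su2 { su2_val :> 'M[R[i]]_2; su2_valP : su2_val \in skew_traceless }.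
HB.instance Definition _ := [isSub for su2_val].
HB.instance Definition _ := [Choice of su2 by <:].
HB.instance Definition _ := [SubChoice_isSubZmodule of su2 by <:].

Fact su2_scale_subproof (a : R) (X : su2) :
  real_complex R a *: su2_val X \in skew_traceless.
Proof.
have := su2_valP X; rewrite !unfold_in => /andP[/eqP hX /eqP tX].
rewrite mxtraceZ tX mulr0 eqxx andbT linearZ /= -scalerN -hX.
apply/eqP/matrixP => i j; rewrite !mxE rmorphM /=; congr (_ * _).
by rewrite /real_complex_def /= oppr0.
Qed.
Definition su2_scale (a : R) (X : su2) : su2 := Su2 (su2_scale_subproof a X).

Fact su2_scaleA a b X : su2_scale a (su2_scale b X) = su2_scale (a * b) X.
Proof. by apply: val_inj; rewrite /= scalerA rmorphM. Qed.
Fact su2_scale1 : left_id 1 su2_scale.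
Proof. by move=> X; apply: val_inj; rewrite /= rmorph1 scale1r. Qed.
Fact su2_scaleDr : right_distributive su2_scale +%R.
Proof. by move=> a X Y; apply: val_inj; rewrite /= scalerDr. Qed.
Fact su2_scaleDl X : {morph su2_scale^~ X : a b / a + b}.
Proof. by move=> a b; apply: val_inj; rewrite /= rmorphD scalerDl. Qed.
HB.instance Definition _ := GRing.Zmodule_isLmodule.Build R su2
  su2_scaleA su2_scale1 su2_scaleDr su2_scaleDl.

Fact su2_bracket_subproof (X Y : su2) :
  su2_val X *m su2_val Y - su2_val Y *m su2_val X \in skew_traceless.
Proof.
have := su2_valP X; have := su2_valP Y; rewrite !unfold_in.
move=> /andP[/eqP hY _] /andP[/eqP hX _].
rewrite linearB /= !trmx_mul map_mxB !map_mxM hX hY !mulNmx !mulmxN !opprK opprB eqxx /=.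
by rewrite linearB /= mxtrace_mulC subrr.
Qed.
Definition su2_bracket (X Y : su2) : su2 := Su2 (su2_bracket_subproof X Y).

Definition su2_coords (X : su2) : 'rV[R]_3 :=
  \row_i [:: complex.Im (su2_val X 0 0); complex.Re (su2_val X 0 1);
             complex.Im (su2_val X 0 1)]`_i.

Definition su2_mx (a b c : R) : 'M[R[i]]_2 :=
  \matrix_(i, j) if i == 0 then (if j == 0 then Complex 0 a else Complex b c)
                 else (if j == 0 then Complex (- b) c else Complex 0 (- a)).

Fact su2_mx_subproof a b c : su2_mx a b c \in skew_traceless.
Proof.
rewrite unfold_in; apply/andP; split; apply/eqP; last first.
  by rewrite /mxtrace !big_ord_recl big_ord0 !mxE /=; apply/eqP; rewrite eq_complex /= !addr0 subrr eqxx.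
apply/matrixP => i j; rewrite !mxE.
by case: i => [[|[|//]]] ?; case: j => [[|[|//]]] ? /=; apply/eqP; rewrite eq_complex /= ?oppr0 ?opprK ?eqxx.
Qed.

Fact su2_mxE (X : su2) :
  su2_val X = su2_mx (su2_coords X 0 0) (su2_coords X 0 1) (su2_coords X 0 2).
Proof.
have I2 (i : 'I_2) : i = 0 \/ i = 1.
  by case: i => [[|[|//]]] ?; [left|right]; apply: val_inj.
have := su2_valP X; rewrite unfold_in => /andP[/eqP/matrixP hX /eqP].
rewrite /mxtrace big_ord_recl big_ord1 (_ : lift _ _ = 1); last exact: val_inj.
have := hX 0 0; have := hX 0 1; rewrite !mxE /= => h01 h00 tX.
apply/matrixP => i j; rewrite !mxE.
move: h01 h00 tX => /eqP + /eqP + /eqP.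
case: (I2 i) => ->; case: (I2 j) => -> /=;
  move: (su2_val X 0 0) (su2_val X 0 1) (su2_val X 1 0) (su2_val X 1 1);
  move=> [a b] [c d] [e f] [g h]; rewrite !eq_complex /=;
  move=> /andP[/eqP ? /eqP ?] /andP[/eqP ? /eqP ?] /andP[/eqP ? /eqP ?];
  apply/eqP; rewrite eq_complex /=; apply/andP; split; apply/eqP; lra.
Qed.

Fact su2_vect_iso : Vector.axiom 3 su2.
Proof.
exists su2_coords.
  move=> a X Y; apply/rowP => i; rewrite !mxE.
  case: i => [[|[|[|//]]]] ? /=.
  - by case: (su2_val X 0 0) (su2_val Y 0 0) => ? ? [? ?] /=; rewrite mul0r addr0.
  - by case: (su2_val X 0 1) (su2_val Y 0 1) => ? ? [? ?] /=; rewrite mul0r subr0.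
  - by case: (su2_val X 0 1) (su2_val Y 0 1) => ? ? [? ?] /=; rewrite mul0r addr0.
exists (fun v : 'rV[R]_3 => Su2 (su2_mx_subproof (v 0 0) (v 0 1) (v 0 2))) => [X|v].
  by apply: val_inj; rewrite /= -su2_mxE.
by apply/rowP => -[[|[|[|//]]]] ?; rewrite !mxE /=;
  congr (v _ _); apply: val_inj.
Qed.
HB.instance Definition _ := Lmodule_hasFinDim.Build R su2 su2_vect_iso.
End Su2.

Section Forms.
Variable R : realType.

Definition lie_bracket (X Y : su2 R * su2 R) : su2 R * su2 R :=
  (su2_bracket X.1 Y.1, su2_bracket X.2 Y.2).

(* Left-invariant k-forms on SU(2)^2, identified with their values on k
   elements of the Lie algebra su(2) (+) su(2).  The type does not impose
   multilinearity and alternation: every form below is built from linear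
   1-forms by linear combinations, wedge products and d, which preserve both.
   Forms on SU(2)^2 / U(1) are identified with their pullbacks to SU(2)^2;
   pullback is injective, so equations may be read upstairs, where the
   connection 1-form lives.
   R^o is R as a module over itself, so that forms carry the pointwise
   module structure. *)
Definition form (k : nat) := ('I_k -> su2 R * su2 R) -> R^o.

(* Normalized so that (a \^ b)(X, Y) = a(X) b(Y) - a(Y) b(X) on 1-forms. *)
Definition wedge (p q : nat) (a : form p) (b : form q) : form (p + q) :=
  fun X => ((p`! * q`!)%:R)^-1 *
    \sum_(s : 'S_(p + q)) (-1) ^+ s *
      a (fun i => X (s (lshift q i))) * b (fun j => X (s (rshift p j))).

(* The exterior derivative of a left-invariant form on left-invariant fields:
   sum over i < j of (-1)^(i+j) a([X_i, X_j], X_0, .., X_k), where X_i and X_j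
   are omitted after the bracket.  The terms X_i(a(..)) of the general formula
   vanish, because left-invariant forms are constant on left-invariant
   fields. *)
Definition ext_d (k : nat) (a : form k) : form k.+1 :=
  fun X => \sum_(j < k.+1) \sum_(i < k.+1 | (i < j)%N) (-1) ^+ (i + j) *
    a (fun m => if m == 0%N :> nat then lie_bracket (X i) (X j)
                else X (inord (bump j (bump i m.-1)))).

Definition form_dt (k : nat) (a : R -> form k) (t : R) : form k :=
  fun X => derive1 (fun s => (a s X : R)) t.

(* Addition of indices is modulo 3, so the second clause is
   [E_i, E_j] = 2 E_k for (i j k) cyclic. *)
Definition su2_frame (E : 3.-tuple (su2 R)) : Prop :=
  basis_of fullv E /\
  forall i : 'I_3, su2_bracket (tnth E i) (tnth E (i + 1)) =
                   2 *: tnth E (i + 2).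
End Forms.

Notation "a \^ b" := (wedge a b) (at level 40, left associativity) : ring_scope.

Section Structures.
Variables (R : realType) (E : 3.-tuple (su2 R)).

Definition u1 : form R 1 := fun X => coord E 0 (X 0).1.
Definition v1 : form R 1 := fun X => coord E 1 (X 0).1.
Definition w1 : form R 1 := fun X => coord E 2 (X 0).1.
Definition u2 : form R 1 := fun X => coord E 0 (X 0).2.
Definition v2 : form R 1 := fun X => coord E 1 (X 0).2.
Definition w2 : form R 1 := fun X => coord E 2 (X 0).2.
Definition u_plus : form R 1 := 2^-1 *: (u1 + u2).
Definition u_minus : form R 1 := 2^-1 *: (u1 - u2).

Definition eta_se : form R 1 := (4 / 3) *: u_minus.
Definition theta_se : form R 1 := (4 / 3) *: u_plus.
Definition omega_se (j : 'I_4) : form R 2 :=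
  tnth [tuple (2 / 3) *: (v1 \^ w1 + v2 \^ w2);
              - (2 / 3) *: (v1 \^ w1 - v2 \^ w2);
              (2 / 3) *: (v1 \^ v2 + w1 \^ w2);
              (2 / 3) *: (v1 \^ w2 - w1 \^ v2)] j.

Definition minkowski : 'M[R]_4 :=
  diag_mx (\row_(j < 4) if j == 0 then -1 else 1).
Definition SO13 : set 'M[R]_4 :=
  [set A | A *m minkowski *m A^T = minkowski /\ \det A = 1].
Definition SO13_0 : set 'M[R]_4 := connected_component SO13 1%:M.

Record su2_structure := SU2Structure {
  lam : R;
  mu : R;
  mixing : 'M[R]_4;
  lam_gt0 : 0 < lam;
  mu_gt0 : 0 < mu;
  mixing_SO13_0 : SO13_0 mixing }.

Definition eta (S : su2_structure) : form R 1 := lam S *: eta_se.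
(* The 2-forms of the structure are those with i = 1, 2, 3. *)
Definition omega (S : su2_structure) (i : 'I_4) : form R 2 :=
  mu S *: \sum_(j < 4) mixing S i j *: omega_se j.

Definition connection (alpha : R -> R) (k : R) : R -> form R 1 :=
  fun t => alpha t *: eta_se + k *: theta_se.

(* The two signs of mixing 3 0 give two structures; the argument k, which is
   1/2 or -1/2, selects the one of opposite sign. *)
Definition nearly_kahler (S : su2_structure) (k : R) : Prop :=
  lam S = Num.sqrt 3 / 2 /\ mu S = Num.sqrt 3 / 3 /\
  exists vartheta : R,
  [/\ omega S 1 = mu S *: omega_se 1,
      omega S 2 = (Num.sqrt 3 / 3) *:
        (cos vartheta *: omega_se 2 - sin vartheta *: omega_se 3),
      omega S 3 = mu S *: (mixing S 3 0 *: omega_se 0 +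
        mixing S 3 2 *: omega_se 2 + mixing S 3 3 *: omega_se 3) &
      [/\ mixing S 3 0 = - Num.sg k * (Num.sqrt 3 / 3),
          mixing S 3 3 = 2 / Num.sqrt 3 * cos vartheta &
          mixing S 3 2 = 2 / Num.sqrt 3 * sin vartheta]].

(* The derivability clause makes the derivative in form_dt meaningful. *)
Definition is_solution (S : su2_structure) (theta : R -> form R 1) : Prop :=
  forall t : R, 0 < t ->
  [/\ forall X, derivable (fun s => (theta s X : R)) t 1,
      ext_d (omega S 3) = 4 *: (eta S \^ omega S 2) :> form R 3,
      ext_d (theta t) \^ eta S \^ omega S 2 = 0 :> form R 5,
      2 *: (omega S 1 \^ omega S 1) - (ext_d (eta S \^ omega S 1) : form R 4) =
        ext_d (theta t) \^ omega S 3 +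
        ((t *: form_dt theta t) \^ eta S \^ omega S 2 : form R 4)
        :> form R 4 &
      (ext_d (omega S 2) : form R 3) + 3 *: (eta S \^ omega S 3 : form R 3) =
        ((t *: form_dt theta t) \^ omega S 1 : form R 3) +
        (ext_d (theta t) \^ eta S : form R 3)
        :> form R 3].
End Structures.

(* Main.v *)
Require Import Defs.
From mathcomp Require Import all_boot all_order all_algebra all_fingroup.
From mathcomp Require Import all_classical all_reals all_analysis.
From mathcomp.real_closed Require Import complex.
From mathcomp Require Import ring.
Import Order.TTheory GRing.Theory Num.Theory.
Import numFieldNormedType.Exports.
(* [form], shadowed by the forms of sesquilinear.v, is meant in the sense of
   Defs. *)
Import Defs.
Set Implicit Arguments.
Unset Strict Implicit.
Local Open Scope ring_scope.

(* The Maurer-Cartan equations du^a = -2 v^a /\ w^a (and cyclic) yield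
     d eta^se = 2 omega_1^se,   d theta^se = -2 omega_0^se,   d omega_0^se = 0,
     d omega_2^se = -3 eta^se /\ omega_3^se,
     d omega_3^se = 3 eta^se /\ omega_2^se,
   and the omega_j^se are pairwise orthogonal, (omega_0^se)^2 being
   -(omega_1^se)^2.  The first two equations then hold for any alpha and k, the
   third one is |k| = 1/2, and the last one is |k| = 1/2 together with
   t alpha' + 3 alpha = 0, whose solutions are alpha = gamma t^-3. *)

(** * Block permutations and their signs *)

Section PermSum.
Variables (p q : nat) (s : 'S_p) (t : 'S_q).

Definition perm_sum_fun (k : 'I_(p + q)) : 'I_(p + q) :=
  match fintype.split k with
  | inl i => lshift q (s i)
  | inr j => rshift p (t j)
  end.

Fact perm_sum_inj : injective perm_sum_fun.
Proof.
move=> k l; rewrite /perm_sum_fun.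
case: split_ordP => i ->; case: split_ordP => j -> /eqP.
- by rewrite eq_lshift => /eqP/perm_inj ->.
- by rewrite eq_lrshift.
- by rewrite eq_rlshift.
- by rewrite eq_rshift => /eqP/perm_inj ->.
Qed.

Definition perm_sum : 'S_(p + q) := perm perm_sum_inj.

Lemma perm_sum_lshift i : perm_sum (lshift q i) = lshift q (s i).
Proof. by rewrite permE /perm_sum_fun (unsplitK (inl i)). Qed.

Lemma perm_sum_rshift j : perm_sum (rshift p j) = rshift p (t j).
Proof. by rewrite permE /perm_sum_fun (unsplitK (inr j)). Qed.

(** The permutation matrix of a block permutation is block diagonal, and signs are determinants of
    permutation matrices. *)
Lemma sign_perm_sum (R : comRingType) :
  (-1) ^+ perm_sum = (-1) ^+ s * (-1) ^+ t :> R.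
Proof.
rewrite -!det_perm -[in RHS](det_lblock _ 0).
congr (\det _); apply/matrixP => k l.
case: (split_ordP k) => i ->; case: (split_ordP l) => j ->;
  rewrite ?block_mxEul ?block_mxEur ?block_mxEdl ?block_mxEdr !mxE;
  rewrite ?perm_sum_lshift ?perm_sum_rshift.
- by rewrite eq_lshift.
- by rewrite eq_lrshift.
- by rewrite eq_rlshift.
- by rewrite eq_rshift.
Qed.
End PermSum.

(* s_0 /\ ... /\ s_(p-1), provided that size s = p. *)
Definition mono (R : realType) (p : nat) (s : seq (form R 1)) : form R p :=
  fun X => \det (\matrix_(i < p, j < p) s`_i (fun=> X j)).
Arguments mono {R} p s _.

(** * Wedge products of monomials, and linearity of the operations *)

Section Forms.
Variable R : realType.

Lemma mono1E (a : form R 1) : mono 1 [:: a] = a.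
Proof.
apply/funext => X; rewrite /mono det_mx11 mxE /=.
by congr a; apply/funext => i; rewrite ord1.
Qed.

(** Leibniz expansion of both determinants turns the sum over shuffled arguments into a triple sum
    over [u], [s1], [t1] of Leibniz terms of [\det M]. For fixed [s1] and [t1], translation by their
    block permutation is a bijection, so the sum over [u] is [\det M]; the number of pairs cancels
    the normalization of [wedge]. *)
Lemma wedge_mono p q (s t : seq (form R 1)) : size s = p ->
  mono p s \^ mono q t = mono (p + q) (s ++ t).
Proof.
move=> hs; apply/funext => X; rewrite /wedge /mono.
set M := \matrix_(i < p + q, j < p + q) (s ++ t)`_i (fun=> X j).
pose F (v : 'S_(p + q)) := (-1) ^+ v * \prod_i M i (v i).
(* Permutations compose from left to right: [perm_sum s1 t1] acts first, then [u]. *)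
have term (u : 'S_(p + q)) :
    (-1) ^+ u * \det (\matrix_(i < p, j < p) s`_i (fun=> X (u (lshift q j)))) *
      \det (\matrix_(i < q, j < q) t`_i (fun=> X (u (rshift p j)))) =
    \sum_(s1 : 'S_p) \sum_(t1 : 'S_q) F (perm_sum s1 t1 * u)%g.
  rewrite -mulrA big_distrlr /= big_distrr /=; apply: eq_bigr => s1 _.
  rewrite big_distrr /=; apply: eq_bigr => t1 _.
  rewrite /F big_split_ord /= odd_permM signr_addb sign_perm_sum.
  rewrite (_ : \prod_(i < p) M _ _ =
      \prod_(i < p) s`_i (fun=> X (u (lshift q (s1 i))))); last first.
    by apply: eq_bigr => i _; rewrite mxE nth_cat /= hs ltn_ord permM
      perm_sum_lshift.
  rewrite (_ : \prod_(i < q) M _ _ =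
      \prod_(i < q) t`_i (fun=> X (u (rshift p (t1 i))))); last first.
    apply: eq_bigr => i _.
    by rewrite mxE nth_cat /= hs ltnNge leq_addr addKn permM perm_sum_rshift.
  under eq_bigr => i _ do rewrite mxE.
  under [X in _ * (_ * (_ * X)) = _]eq_bigr => i _ do rewrite mxE.
  set a := _ ^+ s1; set b := _ ^+ t1; set c := _ ^+ u.
  set x := \prod_(i < p) _; set y := \prod_(i < q) _.
  by rewrite [_ * c]mulrC -[in RHS]mulrA [in RHS]mulrACA.
have tot : \sum_(u : 'S_(p + q)) \sum_(s1 : 'S_p) \sum_(t1 : 'S_q)
    F (perm_sum s1 t1 * u)%g = (p`! * q`!)%:R * \det M.
  rewrite exchange_big /=.
  under eq_bigr => s1 _ do rewrite exchange_big /=.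
  rewrite (eq_bigr (fun=> \sum_(t1 : 'S_q) \det M)); last first.
    move=> s1 _; apply: eq_bigr => t1 _.
    by rewrite /determinant [RHS](reindex_inj (mulgI (perm_sum s1 t1))).
  by rewrite !sumr_const -!mulrnA !card_Sn mulnC mulr_natl.
under eq_bigr => u _ do rewrite term.
by rewrite tot mulrA mulVf ?mul1r.
Qed.

Lemma mono_alt p (s : seq (form R 1)) (i j : 'I_p) :
  i != j -> s`_i = s`_j -> mono p s = 0.
Proof.
move=> ij e; apply/funext => X.
by apply: (determinant_alternate ij) => k; rewrite !mxE e.
Qed.

Lemma wedgeDl p q (a b : form R p) (c : form R q) :
  (a + b) \^ c = a \^ c + b \^ c.
Proof.
apply/funext => X; rewrite /wedge [RHS]/GRing.add /= -mulrDr -big_split /=.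
by congr (_ * _); apply: eq_bigr => s _; rewrite {1}/GRing.add /= mulrDr mulrDl.
Qed.

Lemma wedgeDr p q (a : form R p) (b c : form R q) :
  a \^ (b + c) = a \^ b + a \^ c.
Proof.
apply/funext => X; rewrite /wedge [RHS]/GRing.add /= -mulrDr -big_split /=.
by congr (_ * _); apply: eq_bigr => s _; rewrite -mulrDr.
Qed.

Lemma wedgeZl p q x (a : form R p) (c : form R q) :
  (x *: a) \^ c = x *: (a \^ c).
Proof.
apply/funext => X; rewrite /wedge [RHS]/GRing.scale /= /GRing.scale /=.
rewrite [RHS]mulrCA [x * _]mulr_sumr; congr (_ * _).
by apply: eq_bigr => s _; rewrite mulrCA !mulrA.
Qed.

Lemma wedge0l p q (b : form R q) : (0 : form R p) \^ b = 0.
Proof. by rewrite -(scale0r (0 : form R p)) wedgeZl scale0r. Qed.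

Lemma wedgeZr p q x (a : form R p) (c : form R q) :
  a \^ (x *: c) = x *: (a \^ c).
Proof.
apply/funext => X; rewrite /wedge [RHS]/GRing.scale /= /GRing.scale /=.
rewrite [RHS]mulrCA [x * _]mulr_sumr; congr (_ * _).
by apply: eq_bigr => s _; rewrite mulrCA !mulrA.
Qed.

Lemma ext_dD p (a b : form R p) : ext_d (a + b) = ext_d a + ext_d b.
Proof.
apply/funext => X; rewrite /ext_d [RHS]/GRing.add /= -big_split /=.
by apply: eq_bigr => j _; rewrite -big_split;
  apply: eq_bigr => i _; exact: mulrDr.
Qed.

Lemma ext_dZ p x (a : form R p) : ext_d (x *: a) = x *: ext_d a.
Proof.
apply/funext => X; rewrite /ext_d [RHS]/GRing.scale /= /GRing.scale /=.
rewrite mulr_sumr.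
by apply: eq_bigr => j _; rewrite mulr_sumr;
  apply: eq_bigr => i _; rewrite mulrCA.
Qed.

(** Pointwise evaluation turns equations between forms into equations between reals, within reach of
    [ring] and [field]. *)
Lemma formDE k (a b : form R k) X : (a + b) X = a X + b X. Proof. by []. Qed.
Lemma formNE k (a : form R k) X : (- a) X = - a X. Proof. by []. Qed.
Lemma formZE k x (a : form R k) X : (x *: a) X = x * a X. Proof. by []. Qed.
Lemma form0E k X : (0 : form R k) X = 0. Proof. by []. Qed.

Lemma wedgeNl p q (a : form R p) (b : form R q) : (- a) \^ b = - (a \^ b).
Proof. by rewrite -scaleN1r wedgeZl scaleN1r. Qed.

Lemma wedgeNr p q (a : form R p) (b : form R q) : a \^ (- b) = - (a \^ b).
Proof. by rewrite -scaleN1r wedgeZr scaleN1r. Qed.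

Lemma ext_dN p (a : form R p) : ext_d (- a) = - ext_d a.
Proof. by rewrite -scaleN1r ext_dZ scaleN1r. Qed.

Lemma wedge11 (a b : form R 1) : a \^ b = mono 2 [:: a; b].
Proof. by rewrite -{1}(mono1E a) -{1}(mono1E b) wedge_mono. Qed.

Lemma wedge1_mono q (a : form R 1) s : a \^ mono q s = mono q.+1 (a :: s).
Proof. by rewrite -{1}(mono1E a) wedge_mono. Qed.

Lemma wedge_mono1 p (b : form R 1) s : size s = p ->
  mono p s \^ b = mono (p + 1) (rcons s b).
Proof. by move=> hs; rewrite -{1}(mono1E b) wedge_mono // cats1. Qed.

Definition formE := (formDE, formNE, formZE, form0E).
Definition wedgeE := (wedgeDl, wedgeDr, wedgeNl, wedgeNr, wedgeZl, wedgeZr).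
Definition ext_dE := (ext_dD, ext_dN, ext_dZ).
End Forms.

(** * The bracket of su(2) in a frame *)

Section Su2Lie.
Variables (R : realType) (E : 3.-tuple (su2 R)) (hE : su2_frame E).
Implicit Types x y z : su2 R.

Lemma su2_bracketC x y : su2_bracket x y = - su2_bracket y x.
Proof. by apply: val_inj; rewrite /= opprB. Qed.

Lemma su2_bracketDl x y z :
  su2_bracket (x + y) z = su2_bracket x z + su2_bracket y z.
Proof. by apply: val_inj; rewrite /= mulmxDl mulmxDr addrACA opprD. Qed.

Lemma su2_bracketZl a x z : su2_bracket (a *: x) z = a *: su2_bracket x z.
Proof.
by apply: val_inj => /=; rewrite -scalemxAl -scalemxAr -scalerBr.
Qed.

Lemma su2_bracketDr x y z :
  su2_bracket x (y + z) = su2_bracket x y + su2_bracket x z.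
Proof. by rewrite su2_bracketC su2_bracketDl opprD -!(su2_bracketC x). Qed.

Lemma su2_bracketZr a x y : su2_bracket x (a *: y) = a *: su2_bracket x y.
Proof. by rewrite su2_bracketC su2_bracketZl -scalerN -su2_bracketC. Qed.

Lemma su2_bracketxx x : su2_bracket x x = 0.
Proof. by apply: val_inj; rewrite /= subrr. Qed.

(** In a frame the bracket is twice the cross product; indices are modulo 3. *)
Lemma coord_su2_bracket (i : 'I_3) x y :
  coord E i (su2_bracket x y) =
  2 * (coord E (i + 1) x * coord E (i + 2) y
     - coord E (i + 2) x * coord E (i + 1) y).
Proof.
have [bE hc] := hE.
have fE := basis_free bE.
have ex z : z = coord E 0 z *: E`_0 + coord E 1 z *: E`_1 + coord E 2 z *: E`_2.
  rewrite {1}(coord_basis bE (memvf z)) !big_ord_recl big_ord0 addr0 addrA.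
  have -> : lift ord0 (lift ord0 ord0) = 2 :> 'I_3 by exact: val_inj.
  by have -> : lift ord0 ord0 = 1 :> 'I_3 by exact: val_inj.
have c01 : su2_bracket E`_0 E`_1 = 2 *: E`_2.
  by have := hc 0; rewrite !(tnth_nth 0).
have c12 : su2_bracket E`_1 E`_2 = 2 *: E`_0.
  by have := hc 1; rewrite !(tnth_nth 0).
have c20 : su2_bracket E`_2 E`_0 = 2 *: E`_1.
  by have := hc 2; rewrite !(tnth_nth 0).
have c10 : su2_bracket E`_1 E`_0 = - (2 *: E`_2) by rewrite su2_bracketC c01.
have c21 : su2_bracket E`_2 E`_1 = - (2 *: E`_0) by rewrite su2_bracketC c12.
have c02 : su2_bracket E`_0 E`_2 = - (2 *: E`_1) by rewrite su2_bracketC c20.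
rewrite [in LHS](ex x) [in LHS](ex y).
rewrite !(su2_bracketDl, su2_bracketDr, su2_bracketZl, su2_bracketZr).
rewrite !su2_bracketxx c01 c12 c20 c10 c21 c02.
have cD (k : 'I_3) u v : coord E k (u + v) = coord E k u + coord E k v.
  exact: linearD.
have cZ (k : 'I_3) a u : coord E k (a *: u) = a * coord E k u by exact: linearZ.
have cN (k : 'I_3) u : coord E k (- u) = - coord E k u by exact: linearN.
have c0 (k : 'I_3) : coord E k 0 = 0 by exact: linear0.
rewrite !(cD, cZ, cN, c0).
have cE (k : 'I_3) (j : nat) : (j < 3)%N -> coord E k E`_j = (k == j :> nat)%:R.
  by move=> hj; rewrite (coord_free (Ordinal hj) k fE) eq_sym.
rewrite !cE //.
case: i => [[|[|[|//]]]] hi /=; rewrite !(mulr0, mulr1, addr0, add0r, oppr0).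
- have -> : Ordinal hi = 0 by exact: val_inj.
  have -> : 0 + 1 = 1 :> 'I_3 by exact: val_inj.
  have -> : 0 + 2 = 2 :> 'I_3 by exact: val_inj.
  ring.
- have -> : Ordinal hi + 1 = 2 by exact: val_inj.
  have -> : Ordinal hi + 2 = 0 by exact: val_inj.
  ring.
- have -> : Ordinal hi + 1 = 0 by exact: val_inj.
  have -> : Ordinal hi + 2 = 1 by exact: val_inj.
  ring.
Qed.
End Su2Lie.

(** * Exterior derivatives of monomials of degree at most three *)

Section ExtD.
Variable R : realType.

Lemma mono_expand p (a : form R 1) s X : mono p.+1 (a :: s) X =
  \sum_(j < p.+1) (-1) ^+ j * a (fun=> X j) * mono p s (fun i => X (lift j i)).
Proof.
rewrite /mono (expand_det_row _ 0); apply: eq_bigr => j _.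
rewrite mxE /= /cofactor add0n mulrCA mulrA; congr (_ * \det _).
by apply/matrixP => i k; rewrite !mxE.
Qed.

Lemma mono0E X : mono 0 [::] X = 1 :> R.
Proof. by rewrite /mono det_mx00. Qed.

(** Presenting the arguments as a list lets evaluation at concrete indices, such as those produced
    by [lift] and [inord], reduce by computation. The default of [nth] is never reached. *)
Lemma ord2_fun T (X : 'I_2 -> T) :
  exists x0 x1, X = fun i : 'I_2 => nth x0 [:: x0; x1] i.
Proof.
exists (X 0), (X 1); apply/funext => -[[|[|//]]] hi /=; congr X;
  exact: val_inj.
Qed.

Lemma ord3_fun T (X : 'I_3 -> T) :
  exists x0 x1 x2, X = fun i : 'I_3 => nth x0 [:: x0; x1; x2] i.
Proof.
exists (X 0), (X 1), (X 2);
apply/funext => -[[|[|[|//]]]] hi /=; congr X;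
  exact: val_inj.
Qed.

Lemma ord4_fun T (X : 'I_4 -> T) :
  exists x0 x1 x2 x3, X = fun i : 'I_4 => nth x0 [:: x0; x1; x2; x3] i.
Proof.
exists (X 0), (X 1), (X 2), (X 3);
apply/funext => -[[|[|[|[|//]]]]] hi /=; congr X;
  exact: val_inj.
Qed.

Implicit Types (a b c p q r s t u : form R 1) (x y z : R).

Lemma mono2E a b (X : 'I_2 -> su2 R * su2 R) : mono 2 [:: a; b] X =
  a (fun=> X 0) * b (fun=> X 1) - a (fun=> X 1) * b (fun=> X 0).
Proof.
have [x0 [x1 ->]] := ord2_fun X.
do 2![rewrite !mono_expand !big_ord_recl !big_ord0 /=].
by rewrite !mono0E /bump /=; ring.
Qed.

Lemma mono3E a b c (X : 'I_3 -> su2 R * su2 R) : mono 3 [:: a; b; c] X =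
    a (fun=> X 0) *
      (b (fun=> X 1) * c (fun=> X 2) - b (fun=> X 2) * c (fun=> X 1))
  - a (fun=> X 1) *
      (b (fun=> X 0) * c (fun=> X 2) - b (fun=> X 2) * c (fun=> X 0))
  + a (fun=> X 2) *
      (b (fun=> X 0) * c (fun=> X 1) - b (fun=> X 1) * c (fun=> X 0)).
Proof.
have [x0 [x1 [x2 ->]]] := ord3_fun X.
rewrite mono_expand !big_ord_recl !big_ord0 /=.
by rewrite !mono2E /bump /=; ring.
Qed.

Lemma mono4E a b c s (X : 'I_4 -> su2 R * su2 R) : mono 4 [:: a; b; c; s] X =
  a (fun=> X 0) *
      mono 3 [:: b; c; s] (fun i : 'I_3 => nth (X 0) [:: X 1; X 2; X 3] i)
  - a (fun=> X 1) *
      mono 3 [:: b; c; s] (fun i : 'I_3 => nth (X 0) [:: X 0; X 2; X 3] i)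
  + a (fun=> X 2) *
      mono 3 [:: b; c; s] (fun i : 'I_3 => nth (X 0) [:: X 0; X 1; X 3] i)
  - a (fun=> X 3) *
      mono 3 [:: b; c; s] (fun i : 'I_3 => nth (X 0) [:: X 0; X 1; X 2] i).
Proof.
have [x0 [x1 [x2 [x3 ->]]]] := ord4_fun X.
rewrite mono_expand !big_ord_recl !big_ord0 /=.
by rewrite !mono3E /bump /=; ring.
Qed.

Lemma ext_d1E a (X : 'I_2 -> su2 R * su2 R) :
  ext_d a X = - a (fun=> lie_bracket (X 0) (X 1)).
Proof.
(* As a monomial, [a] visibly depends only on the value of its argument at index 0, where [ext_d]
   puts the bracket. *)
rewrite -{1}(mono1E a); have [x0 [x1 ->]] := ord2_fun X.
rewrite /ext_d !big_ord_recl !big_ord0 /=.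
rewrite !(big_mkcond (fun i : 'I_2 => _ < _)%N) !big_ord_recl !big_ord0 /=.
rewrite !mono_expand !big_ord_recl !big_ord0 /=.
by rewrite !mono0E /= ?inordK //=; ring.
Qed.

(** A structure equation read backwards: it gives the values on brackets, through which alone
    [ext_d] of a higher monomial depends on the Lie algebra. *)
Lemma form1_bracket a p q x : ext_d a = x *: mono 2 [:: p; q] ->
  forall X Y, a (fun=> lie_bracket X Y) =
  - (x * (p (fun=> X) * q (fun=> Y) - p (fun=> Y) * q (fun=> X))).
Proof.
move=> da X Y.
have := congr1 (fun f : form R 2 => f (fun i : 'I_2 => nth X [:: X; Y] i)) da.
rewrite ext_d1E /= => /(congr1 -%R); rewrite opprK => ->.
by congr (- (_ * _)); rewrite mono2E.
Qed.

(** The Leibniz rule for a product of two 1-forms with decomposable derivatives, checked by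
    evaluation on three vectors. *)
Lemma ext_d_mono2 a b p q r s x y :
  ext_d a = x *: mono 2 [:: p; q] -> ext_d b = y *: mono 2 [:: r; s] ->
  ext_d (mono 2 [:: a; b]) =
  x *: mono 3 [:: p; q; b] - y *: mono 3 [:: a; r; s].
Proof.
move=> /form1_bracket da /form1_bracket db.
apply/funext => X; have [x0 [x1 [x2 ->]]] := ord3_fun X.
rewrite /ext_d !big_ord_recl !big_ord0 /=.
rewrite !(big_mkcond (fun i : 'I_3 => _ < _)%N) !big_ord_recl !big_ord0 /=.
set Y := (fun i : 'I_3 => _).
rewrite [RHS](_ : _ = x * mono 3 [:: p; q; b] Y - y * mono 3 [:: a; r; s] Y) //.
rewrite /Y.
rewrite !mono2E !mono3E /= ?inordK //= !(da, db) /bump /=.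
ring.
Qed.

Lemma ext_d_mono3 a b c p q r s t u x y z :
  ext_d a = x *: mono 2 [:: p; q] -> ext_d b = y *: mono 2 [:: r; s] ->
  ext_d c = z *: mono 2 [:: t; u] ->
  ext_d (mono 3 [:: a; b; c]) =
  x *: mono 4 [:: p; q; b; c] - y *: mono 4 [:: a; r; s; c] +
  z *: mono 4 [:: a; b; t; u].
Proof.
move=> /form1_bracket da /form1_bracket db /form1_bracket dc.
apply/funext => X; have [x0 [x1 [x2 [x3 ->]]]] := ord4_fun X.
rewrite /ext_d !big_ord_recl !big_ord0 /=.
rewrite !(big_mkcond (fun i : 'I_4 => _ < _)%N) !big_ord_recl !big_ord0 /=.
set Y := (fun i : 'I_4 => _).
rewrite [RHS](_ : _ = x * mono 4 [:: p; q; b; c] Y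
 - y * mono 4 [:: a; r; s; c] Y + z * mono 4 [:: a; b; t; u] Y) // /Y.
rewrite !mono4E !mono3E /= ?inordK //= !(da, db, dc) /bump /=.
ring.
Qed.

End ExtD.

(** * Algebra of the standard forms *)

Section StructureEquations.
Variables (R : realType) (E : 3.-tuple (su2 R)).
Local Notation form := (form R).
Local Notation u1 := (u1 E).
Local Notation v1 := (v1 E).
Local Notation w1 := (w1 E).
Local Notation u2 := (u2 E).
Local Notation v2 := (v2 E).
Local Notation w2 := (w2 E).
Local Notation eta_se := (eta_se E).
Local Notation theta_se := (theta_se E).
Local Notation omega_se := (omega_se E).

Lemma eta_seE : eta_se = (2 / 3) *: (u1 - u2).
Proof. by rewrite /Defs.eta_se /u_minus scalerA; congr (_ *: _); field. Qed.

Lemma theta_seE : theta_se = (2 / 3) *: (u1 + u2).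
Proof. by rewrite /Defs.theta_se /u_plus scalerA; congr (_ *: _); field. Qed.

Lemma omega_se0E : omega_se 0 =
  (2 / 3) *: (mono 2 [:: v1; w1] + mono 2 [:: v2; w2]).
Proof. by rewrite -!wedge11. Qed.

Lemma omega_se1E : omega_se 1 =
  - (2 / 3) *: (mono 2 [:: v1; w1] - mono 2 [:: v2; w2]).
Proof. by rewrite -!wedge11. Qed.

Lemma omega_se2E : omega_se 2 =
  (2 / 3) *: (mono 2 [:: v1; v2] + mono 2 [:: w1; w2]).
Proof. by rewrite -!wedge11. Qed.

Lemma omega_se3E : omega_se 3 =
  (2 / 3) *: (mono 2 [:: v1; w2] - mono 2 [:: w1; v2]).
Proof. by rewrite -!wedge11. Qed.

Definition omega_seE := (omega_se0E, omega_se1E, omega_se2E, omega_se3E).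

Lemma eta_se_sq : eta_se \^ eta_se = 0.
Proof.
rewrite eta_seE !wedgeE !wedge11; apply/funext => X.
by rewrite !formE !mono2E; ring.
Qed.

Lemma ord4P (i : 'I_4) : [\/ i = 0, i = 1, i = 2 | i = 3].
Proof.
case: i => [[|[|[|[|//]]]]] hi;
  [apply: Or41|apply: Or42|apply: Or43|apply: Or44]; exact: val_inj.
Qed.

(** The repetitions that occur in a product of two 2-monomials: one copy of [a] in each pair. *)
Lemma mono4_dup (a b d : form 1) :
  (mono 4 [:: a; b; a; d] = 0) * (mono 4 [:: a; b; d; a] = 0) *
  (mono 4 [:: b; a; a; d] = 0) * (mono 4 [:: b; a; d; a] = 0).
Proof.
split; first split; first split.
- exact: (@mono_alt _ _ _ (@Ordinal 4 0 isT) (@Ordinal 4 2 isT)).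
- exact: (@mono_alt _ _ _ (@Ordinal 4 0 isT) (@Ordinal 4 3 isT)).
- exact: (@mono_alt _ _ _ (@Ordinal 4 1 isT) (@Ordinal 4 2 isT)).
- exact: (@mono_alt _ _ _ (@Ordinal 4 1 isT) (@Ordinal 4 3 isT)).
Qed.

(** Only the mixed products of v^1 /\ w^1 and v^2 /\ w^2 survive in either square, with opposite
    signs. This is the Lorentzian sign of index 0. *)
Lemma wedge_omega_se00 :
  omega_se 0 \^ omega_se 0 = - (omega_se 1 \^ omega_se 1).
Proof.
rewrite !omega_seE !wedgeE !wedge_mono //= !mono4_dup; apply/funext => X.
by rewrite !formE !mono4E !mono3E /=; ring.
Qed.

(** Every monomial repeats a factor, except for the indices 0 and 1, where the two mixed products
    cancel because 2-forms commute. *)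
Lemma wedge_omega_se i j : i != j -> omega_se i \^ omega_se j = 0.
Proof.
have [] := ord4P i => ->; have [] := ord4P j => -> // _;
  rewrite !omega_seE !wedgeE !wedge_mono //= ?mono4_dup; apply/funext => X;
  by rewrite !formE ?mono4E ?mono3E /=; ring.
Qed.

Lemma wedge_omega_eta_se i : omega_se i \^ eta_se = eta_se \^ omega_se i.
Proof.
have [] := ord4P i => ->;
  rewrite !(eta_seE, omega_seE) !wedgeE !wedge_mono1 // !wedge1_mono /=;
  apply/funext => X; by rewrite !formE !mono3E /=; ring.
Qed.

(** As [mono4_dup], with the factor [c] of eta^se between the two pairs. *)
Lemma mono5_dup (a b c d : form 1) :
  (mono 5 [:: a; b; c; a; d] = 0) * (mono 5 [:: a; b; c; d; a] = 0) *
  (mono 5 [:: b; a; c; a; d] = 0) * (mono 5 [:: b; a; c; d; a] = 0).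
Proof.
split; first split; first split.
- exact: (@mono_alt _ _ _ (@Ordinal 5 0 isT) (@Ordinal 5 3 isT)).
- exact: (@mono_alt _ _ _ (@Ordinal 5 0 isT) (@Ordinal 5 4 isT)).
- exact: (@mono_alt _ _ _ (@Ordinal 5 1 isT) (@Ordinal 5 3 isT)).
- exact: (@mono_alt _ _ _ (@Ordinal 5 1 isT) (@Ordinal 5 4 isT)).
Qed.

(** Each monomial of [omega_se i] is some v^a /\ w^a, while those of [omega_se j] take one factor
    from each copy of su(2); so they always share a factor. *)
Lemma wedge_omega_eta_omega_se (i j : 'I_4) : (i < 2 <= j)%N ->
  omega_se i \^ eta_se \^ omega_se j = 0.
Proof.
(* [f] hides the inner wedge product, which [!wedgeE] would unfold. *)
have [] := ord4P i => ->; have [] := ord4P j => -> // _;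
  move Ef: (omega_se _ \^ eta_se) => f; move: Ef;
  rewrite !(eta_seE, omega_seE) !wedgeE !wedge_mono1 //= => <-;
  by rewrite !wedgeE !wedge_mono //= !mono5_dup !(subr0, addr0, scaler0).
Qed.

(** * Structure equations of the standard forms *)

Hypothesis hE : su2_frame E.

Lemma ext_d_frame :
  [/\ ext_d u1 = - 2 *: mono 2 [:: v1; w1],
      ext_d v1 = - 2 *: mono 2 [:: w1; u1] &
      ext_d w1 = - 2 *: mono 2 [:: u1; v1]] /\
  [/\ ext_d u2 = - 2 *: mono 2 [:: v2; w2],
      ext_d v2 = - 2 *: mono 2 [:: w2; u2] &
      ext_d w2 = - 2 *: mono 2 [:: u2; v2]].
Proof.
have o00 : 0 + 1 = 1 :> 'I_3 by exact: val_inj.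
have o02 : 0 + 2 = 2 :> 'I_3 by exact: val_inj.
have o11 : 1 + 1 = 2 :> 'I_3 by exact: val_inj.
have o12 : 1 + 2 = 0 :> 'I_3 by exact: val_inj.
have o21 : 2 + 1 = 0 :> 'I_3 by exact: val_inj.
have o22 : 2 + 2 = 1 :> 'I_3 by exact: val_inj.
by do ![split]; apply/funext => X;
  rewrite ext_d1E formE mono2E /Defs.u1 /Defs.v1 /Defs.w1;
  rewrite /Defs.u2 /Defs.v2 /Defs.w2 /= coord_su2_bracket //;
  rewrite ?(o00, o02, o11, o12, o21, o22); ring.
Qed.

Lemma ext_d_eta_se : ext_d eta_se = 2 *: omega_se 1.
Proof.
have [[d1 _ _] [d2 _ _]] := ext_d_frame.
rewrite eta_seE omega_seE !ext_dE d1 d2; apply/funext => X.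
by rewrite !formE; ring.
Qed.

Lemma ext_d_theta_se : ext_d theta_se = - 2 *: omega_se 0.
Proof.
have [[d1 _ _] [d2 _ _]] := ext_d_frame.
rewrite theta_seE omega_seE !ext_dE d1 d2; apply/funext => X.
by rewrite !formE; ring.
Qed.

(** In d(v /\ w) = dv /\ w - v /\ dw both terms repeat a factor. *)
Lemma ext_d_omega_se0 : ext_d (omega_se 0) = 0.
Proof.
have [[du1 dv1 dw1] [du2 dv2 dw2]] := ext_d_frame.
rewrite omega_seE !ext_dE (ext_d_mono2 dv1 dw1) (ext_d_mono2 dv2 dw2).
apply/funext => X.
by rewrite !formE !mono3E; ring.
Qed.

(** With z_a = v^a + i w^a one has dz_a = -2i u^a /\ z_a, and omega_2^se + i omega_3^se is 2/3 of
    conj(z_1) /\ z_2. Its derivative is thus 2i (u^1 - u^2) = 3i eta^se wedged with it; this lemma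
    is the real part and the next one the imaginary part. *)
Lemma ext_d_omega_se2 : ext_d (omega_se 2) = - 3 *: (eta_se \^ omega_se 3).
Proof.
have [[du1 dv1 dw1] [du2 dv2 dw2]] := ext_d_frame.
rewrite !(eta_seE, omega_seE) !ext_dE.
rewrite (ext_d_mono2 dv1 dv2) (ext_d_mono2 dw1 dw2).
rewrite !wedgeE !wedge1_mono; apply/funext => X.
by rewrite !formE !mono3E; field.
Qed.

Lemma ext_d_omega_se3 : ext_d (omega_se 3) = 3 *: (eta_se \^ omega_se 2).
Proof.
have [[du1 dv1 dw1] [du2 dv2 dw2]] := ext_d_frame.
rewrite !(eta_seE, omega_seE) !ext_dE.
rewrite (ext_d_mono2 dv1 dw2) (ext_d_mono2 dw1 dv2).
rewrite !wedgeE !wedge1_mono; apply/funext => X.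
by rewrite !formE !mono3E; field.
Qed.

(** This is d eta^se /\ omega_1^se, since omega_1^se, half of d eta^se, is closed; the proof expands
    into 3-monomials instead. *)
Lemma ext_d_eta_omega_se1 :
  ext_d (eta_se \^ omega_se 1) = 2 *: (omega_se 1 \^ omega_se 1).
Proof.
have [[du1 dv1 dw1] [du2 dv2 dw2]] := ext_d_frame.
rewrite !(eta_seE, omega_seE) !wedgeE !wedge1_mono !ext_dE.
rewrite (ext_d_mono3 du1 dv1 dw1) (ext_d_mono3 du1 dv2 dw2).
rewrite (ext_d_mono3 du2 dv1 dw1) (ext_d_mono3 du2 dv2 dw2).
rewrite !wedge_mono //= !mono4_dup; apply/funext => X.
by rewrite !formE !mono4E !mono3E /=; field.
Qed.
End StructureEquations.

(** * Dependence on t, and verification of the equations *)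

Lemma form_dt_connection (R : realType) (E : 3.-tuple (su2 R)) gamma k t :
  let theta := connection E (fun s => gamma * s ^- 3) k in 0 < t ->
  (forall X, derivable (fun s => (theta s X : R)) t 1) /\
  t *: form_dt theta t = (- 3 * (gamma * t ^- 3)) *: eta_se E.
Proof.
move=> theta t0; have tn0 : t != 0 by rewrite gt_eqF.
(* The coefficient of eta^se is homogeneous of degree -3, so t d/dt multiplies it by -3; the
   theta^se term is constant. *)
have D X : is_derive t 1 (fun s => (theta s X : R))
    (- 3 * (gamma * t ^- 3) / t * eta_se E X).
  have t3 : t ^+ 3 != 0 by rewrite expf_neq0.
  have -> : (fun s => (theta s X : R)) =
    (fun s : R => gamma * (s ^+ 3)^-1 * eta_se E X + k * theta_se E X) by [].
  by apply: is_derive_eq; rewrite /GRing.scale /=; field.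
split=> [X|]; first by have [] := D X.
apply/funext => X; rewrite !formE /form_dt derive1E; have [_ ->] := D X.
by field.
Qed.

Theorem proposition24 (R : realType) (E : 3.-tuple (su2 R)) (hE : su2_frame E)
    (k : R) (hk : k = 1 / 2 \/ k = - (1 / 2))
    (S : su2_structure R) (hS : nearly_kahler E S k) :
  (forall gamma : R,
     is_solution E S (connection E (fun t => gamma * t ^- 3) k)) /\
  (forall gamma gamma' : R,
     (forall t : R, 0 < t ->
        connection E (fun t => gamma * t ^- 3) k t =
        connection E (fun t => gamma' * t ^- 3) k t) ->
     gamma = gamma').
Proof.
have [lamE [muE [th [H1 H2 H3 [A30 A33 A32]]]]] := hS.
have r0 : Num.sqrt 3 != 0 :> R by rewrite gt_eqF // sqrtr_gt0.
have r2 : Num.sqrt 3 ^+ 2 = 3 :> R by rewrite sqr_sqrtr.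
(* This clears the root from the denominators of the mixing coefficients, leaving [r2] as the only
   relation on it. *)
have rV : (Num.sqrt 3)^-1 = Num.sqrt 3 / 3 :> R.
  by apply: (mulfI r0); rewrite mulfV // mulrA -expr2 r2 mulfV.
(* As |k| = 1/2, the coefficient A_30 becomes linear in [k]. *)
have sgk : Num.sg k = 2 * k.
  case: hk => ->; first by rewrite gtr0_sg ?divr_gt0 // mulrA mulr1 mulfV.
  by rewrite ltr0_sg ?oppr_lt0 ?divr_gt0 // mulrN mulrA mulr1 mulfV.
move: H1 H2 H3; rewrite A30 A33 A32 muE sgk rV => H1 H2 H3.
split=> [gamma t t0|gamma gamma' /(_ 1 ltr01)]; last first.
  (* At t = 1 on the vector (E_1, 0), the theta^se terms cancel and eta^se has the nonzero value
     2/3. *)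
  move/(congr1 (fun f => f (fun=> (tnth E 0, 0)))).
  rewrite /= /connection !formE expr1n invr1 !mulr1 => /addIr /mulIf; apply.
  have [/basis_free fE _] := hE.
  rewrite eta_seE !formE /u1 /u2 /= linear0 subr0 (tnth_nth 0) coord_free //.
  by rewrite mulr1 mulf_neq0 // ?invr_eq0 pnatr_eq0.
have tn0 : t != 0 by rewrite gt_eqF.
have [dX dt] := form_dt_connection E gamma k t0.
rewrite dt H1 H2 H3 /eta lamE /connection ext_dD.
rewrite (ext_dZ _ (eta_se E)) (ext_dZ _ (theta_se E)).
rewrite (ext_d_eta_se hE) (ext_d_theta_se hE).
(* The forms are generalized, because the multilinearity rewrite rules would
   unfold their definitions. *)
have dw0 := ext_d_omega_se0 hE; have dw2 := ext_d_omega_se2 hE.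
have dw3 := ext_d_omega_se3 hE; have dew1 := ext_d_eta_omega_se1 hE.
have ee := eta_se_sq E; have w00 := wedge_omega_se00 E.
have ww := @wedge_omega_se _ E.
have we := @wedge_omega_eta_se _ E; have wew := @wedge_omega_eta_omega_se _ E.
split=> //; first clear dX.
all: move: dw0 dw2 dw3 dew1 ee w00 ww we wew.
all: move: (eta_se E) (omega_se E) => e w.
all: move=> dw0 dw2 dw3 dew1 ee w00 ww we wew.
(* Both sides are 2 eta^se /\ (cos omega_2^se - sin omega_3^se). *)
- rewrite !ext_dE !wedgeE dw0 dw2 dw3.
  apply/funext => X; rewrite !formE.
  by field.
(* Here d theta combines omega_0^se and omega_1^se, while omega_2 combines omega_2^se and
   omega_3^se: all four products vanish. *)
- rewrite (wedgeZr _ _ e) wedgeDl !scalerA.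
  rewrite (wedgeZl _ (w 1) e) (wedgeZl _ (w 0) e).
  move: (wew 0 2 isT) (wew 0 3 isT) (wew 1 2 isT) (wew 1 3 isT).
  move: (w 0 \^ e) (w 1 \^ e) => f0 f1; rewrite !wedgeE => -> -> -> ->.
  by rewrite !(subr0, addr0, scaler0).
(* The term in the t-derivative contains eta^se twice. What remains are multiples of (omega_1^se)^2:
   2 mu^2 - 2 lambda mu = -1/3 on the left, 2 k mu A_30 = -4 k^2 / 3 on the right. *)
- rewrite (wedgeZl _ e (_ *: e)) (wedgeZr _ e e) ee.
  rewrite !wedgeE; move: dew1; move: (e \^ w 1) => f; rewrite !ext_dE => ->.
  rewrite (ww 1 0 isT) (ww 1 2 isT) (ww 1 3 isT) (ww 0 2 isT) (ww 0 3 isT).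
  rewrite w00 !wedge0l.
  apply/funext => X; rewrite !formE.
  by case: hk => ->; field.
(* On the left the terms in omega_2^se and omega_3^se cancel by [r2]. The coefficient of eta^se /\
   omega_0^se is -k sqrt 3 on both sides, and that of eta^se /\ omega_1^se on the right is alpha (2
   lambda - 3 mu) = 0, where the exponent -3 enters. *)
- rewrite !wedgeE !ext_dE dw2 dw3 !we.
  apply/funext => X; rewrite !formE.
  by field: r2.
Qed.
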